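(* Let $d\ge 2$ be a fixed integer. For $M>0$, denote by $Z_M$ the number of sources (that is, vertices with in-degree $0$ in the random recursive $d$-DAG $G_n$) among the first $\lfloor Mn^{d/(d+1)}\rfloor$ vertices. As $n\to\infty$, we have $$Z_M\to\mathsf{Poi}\left(\frac{M^{d+1}}{d+1}\right)\quad\text{in distribution},$$ with convergence of all moments. In particular, the threshold for source nodes in $G_n$ is $n^{d/(d+1)}$; that is, letting $S$ be the set of sources of $G_n$, $\mathbb{P}(S\cap[m]\ne\emptyset)\to 0$ if $m=m(n)=o(n^{d/(d+1)})$ and $\mathbb{P}(S\cap[m]\ne\emptyset)\to 1$ if $m=m(n)=\omega(n^{d/(d+1)})$.
   Context: Write $[n]=\{1,\dots,n\}$. Random recursive $d$-DAG: $G_n$ is the directed acyclic (multi)graph on $[n]$ in which each vertex $j\in\{2,\dots,n\}$ has exactly $d$ outgoing arrows, whose targets are chosen independently and uniformly at random from $[j-1]$ (with replacement), independently of the choices at all other vertices. $\mathsf{Poi}(\lambda)$ is the Poisson distribution with parameter $\lambda$. For positive sequences, $f=o(g)$ means $f/g\to0$ and $f=\omega(g)$ means $f/g\to\infty$. *)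

(* Defs.v *)
From HB Require Import structures.
From mathcomp Require Import all_boot all_order all_algebra finmap.
From mathcomp Require Import all_classical all_reals all_analysis.

Set Implicit Arguments.
Unset Strict Implicit.
Unset Printing Implicit Defensive.

Import Order.TTheory GRing.Theory Num.Theory.
Import numFieldNormedType.Exports.

Local Open Scope classical_set_scope.
Local Open Scope ring_scope.

Section independence.
Context {R : realType} {disp : measure_display} {T : measurableType disp}.
Variable P : probability T R.

(* Mutual independence of the family (X i) for i in D. *)
Definition mutually_independent (I : choiceType) (D : set I)
    (disp' : measure_display) (T' : measurableType disp')
    (X : I -> T -> T') : Prop :=
  forall (J : {fset I}) (B : I -> set T'),
    [set` J] `<=` D -> (forall i, measurable (B i)) ->
    P (\bigcap_(i in [set` J]) X i @^-1` B i) =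
      (\prod_(i <- J) fine (P (X i @^-1` B i)))%:E.

End independence.

(* The vertices are 1, ..., n.  The arrows leaving vertex j (2 <= j <= n) are
   labelled by 'I_d, so that parallel arrows are distinct; [target j k] is the
   head of the k-th arrow leaving j, and is meaningless unless 2 <= j <= n. *)
Record random_recursive_dag (R : realType) (disp : measure_display)
    (T : measurableType disp) (P : probability T R) (d n : nat) := RandomDag {
  target : nat -> 'I_d -> {mfun T >-> nat} ;
  target_range : forall (j : nat) (k : 'I_d) (w : T),
    (2 <= j <= n)%N -> (1 <= target j k w < j)%N ;
  target_uniform : forall (j : nat) (k : 'I_d) (i : nat),
    (2 <= j <= n)%N -> (1 <= i < j)%N ->
    P [set w | target j k w = i] = ((j.-1)%:R^-1)%:E ;
  target_independent :
    mutually_independent P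
      [set jk : nat * 'I_d | (2 <= jk.1 <= n)%N]
      (fun jk w => target jk.1 jk.2 w)
}.

Section sources.
Context {R : realType} {disp : measure_display} {T : measurableType disp}.
Context {P : probability T R} {d n : nat}.
Variable G : random_recursive_dag P d n.

Definition in_degree (w : T) (v : nat) : nat :=
  (\sum_(2 <= j < n.+1) \sum_(k < d) (target G j k w == v))%N.

Definition is_source (w : T) (v : nat) : bool :=
  (1 <= v <= n)%N && (in_degree w v == 0%N).

Definition sources (w : T) : set nat := [set v | is_source w v].

(* Real-valued, so as to be a random variable in the sense of [cdf]. *)
Definition num_sources (m : nat) (w : T) : R :=
  \sum_(1 <= v < m.+1) (is_source w v)%:R.

Lemma measurable_is_source (v : nat) :
  measurable_fun [set: T] (fun w => is_source w v).
Proof.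
rewrite /is_source; apply: measurable_and => //.
pose f (w : T) : R := \sum_(2 <= j < n.+1) \sum_(k < d) (target G j k w == v)%:R.
have mf : measurable_fun [set: T] f.
  apply: measurable_sum => j; apply: measurable_sum => k.
  have mg : measurable_fun [set: nat] (fun x : nat => (x == v)%:R : R) by [].
  exact: (measurableT_comp mg).
apply: (measurable_fun_bool true); rewrite setTI.
rewrite [X in measurable X](_ : _ = f @^-1` [set 0]); last first.
  have fE w : f w = (in_degree w v)%:R.
    by rewrite natr_sum; apply: eq_bigr => j _; rewrite natr_sum.
  apply/seteqP; split=> w /=; rewrite fE; first by move/eqP ->.
  by move/eqP; rewrite pnatr_eq0.
by rewrite -[X in measurable X]setTI; exact: mf.
Qed.

Lemma measurable_num_sources (m : nat) :
  measurable_fun [set: T] (num_sources m).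
Proof.
apply: measurable_sum => v.
have mg : measurable_fun [set: bool] (fun b : bool => b%:R : R) by [].
exact: (measurableT_comp mg (measurable_is_source v)).
Qed.

HB.instance Definition _ (m : nat) :=
  isMeasurableFun.Build _ _ _ _ (num_sources m) (measurable_num_sources m).

End sources.

(* The cdfs converge at every continuity point of the limit cdf; the X n may
   live on different probability spaces. *)
Definition cvg_in_distribution (R : realType)
    (disp : nat -> measure_display) (T : forall n, measurableType (disp n))
    (P : forall n, probability (T n) R) (X : forall n, {RV (P n) >-> R})
    (disp' : measure_display) (T' : measurableType disp')
    (Q : probability T' R) (Y : {RV Q >-> R}) : Prop :=
  forall x : R, {for x, continuous (cdf Y)} ->
    cdf (X n) x @[n --> \oo] --> cdf Y x.

Section poisson.
Context {R : realType}.

(* The last argument of [poisson_prob] is a dummy. *)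
Definition Poi (lambda : R) : probability nat R := poisson_prob lambda 0%N.

Definition nat_to_real (k : nat) : R := k%:R.

Lemma measurable_nat_to_real : measurable_fun [set: nat] nat_to_real.
Proof. by []. Qed.

HB.instance Definition _ :=
  isMeasurableFun.Build _ _ _ _ nat_to_real measurable_nat_to_real.

(* A random variable with law Poi(lambda): the identity of nat, under Poi. *)
Definition poisson_rv (lambda : R) : {RV (Poi lambda) >-> R} := nat_to_real.

End poisson.

(* Main.v *)
(* By independence of the arrows, for v_1 < ... < v_k the probability that v_1, ..., v_k
   are all sources telescopes to the product of the ((v_i - i) / (n - i))^d.  Summing over
   the k-subsets of [m] squeezes the k-th binomial moment E C(Z, k) between
   (p(m - k) / n^d)^k / k! and (p(m) / (n - k)^d)^k / k!, where p(m) = 1^d + ... + m^d is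
   asymptotic to m^(d+1) / (d+1).  For m ~ M n^(d/(d+1)) it therefore tends to lambda^k / k!
   with lambda = M^(d+1) / (d+1), which is the k-th binomial moment of Poi(lambda).  The
   Bonferroni inequalities turn this into convergence of P(Z = r) for every r, and powers
   are nonnegative combinations of binomial coefficients, whence the moments.  Below the
   threshold E Z tends to 0; above it P(Z = 0) is eventually at most about exp(- lambda)
   for every M. *)
Require Import Defs.
From HB Require Import structures.
From mathcomp Require Import all_boot all_order all_algebra finmap.
From mathcomp Require Import all_classical all_reals all_analysis.
From mathcomp Require Import measurable_realfun ring lra zify.

Import Order.TTheory GRing.Theory Num.Theory.
Import numFieldNormedType.Exports.

Local Open Scope classical_set_scope.
Local Open Scope ring_scope.

(** * Binomial identities *)

(** Pascal's rule makes the alternating sum telescope. The upper index is a successor because the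
    value at 0 follows a different formula. *)
Lemma sum_signed_bin (R : pzRingType) (y s : nat) :
  \sum_(i < s.+1) (-1) ^+ i * 'C(y.+1, i)%:R = (-1) ^+ s * 'C(y, s)%:R :> R.
Proof.
elim: s => [|s IHs]; first by rewrite big_ord1 !bin0.
by rewrite big_ord_recr/= IHs binS natrD exprS mulrDr mulN1r !mulNr addrCA subrr addr0.
Qed.

(** For y, s > 0 the truncation error is exactly C(y - 1, s - 1) in absolute value, at most the
    first omitted term. *)
Lemma bonferroni0 (R : realDomainType) (y s : nat) :
  `|(y == 0)%N%:R - \sum_(i < s) (-1) ^+ i * 'C(y, i)%:R| <= 'C(y, s)%:R :> R.
Proof.
case: y => [|y]; case: s => [|s].
- by rewrite big_ord0 subr0 normr1.
- rewrite big_ord_recl/= bin0 big1 ?mulr1 ?addr0 ?subrr ?normr0//.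
  by move=> i _; rewrite bin0n mulr0.
- by rewrite big_ord0 subr0 normr0.
- rewrite sum_signed_bin sub0r normrN normrM normrX normrN1 expr1n mul1r normr_nat.
  by rewrite ler_nat binS leq_addl.
Qed.

(** Both sides count pairs of an (r + i)-subset of a z-set and an r-subset of it. *)
Lemma bin_mul_bin (z r i : nat) : ('C(r + i, r) * 'C(z, r + i) = 'C(z, r) * 'C(z - r, i))%N.
Proof.
have [ltz|lez] := ltnP z (r + i).
  have [ltr|ler] := ltnP z r; first by rewrite (bin_small ltz) (bin_small ltr) muln0.
  by rewrite (bin_small ltz) (@bin_small (z - r)) ?muln0//; lia.
have h1 := bin_fact lez.
have h2 := bin_fact (leq_addr i r).
have h3 := @bin_fact z r ltac:(lia).
have h4 := @bin_fact (z - r) i ltac:(lia).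
have e1 : (r + i - r = i)%N by lia.
have e2 : (z - r - i = z - (r + i))%N by lia.
rewrite e1 in h2; rewrite e2 in h4.
have : (0 < r`! * (i`! * (z - (r + i))`!))%N by rewrite !muln_gt0 !fact_gt0.
move=> w_gt0; apply/eqP; rewrite -(eqn_pmul2r w_gt0); apply/eqP.
transitivity (z`!); first by rewrite -h1 -h2; ring.
by rewrite -h3 -h4; ring.
Qed.

Lemma bonferroni (R : realDomainType) (z r s : nat) :
  `|(z == r)%:R - \sum_(i < s) (-1) ^+ i * ('C(r + i, r) * 'C(z, r + i))%:R|
    <= ('C(r + s, r) * 'C(z, r + s))%:R :> R.
Proof.
(* With C(z, r) factored out, the claim is [bonferroni0] at z - r. When z < r the truncated
   difference is also 0, but C(z, r) vanishes. *)
have -> : (z == r)%:R = 'C(z, r)%:R * (z - r == 0)%N%:R :> R.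
  have [ltzr|lerz] := ltnP z r; first by rewrite bin_small// mul0r ltn_eqF.
  by rewrite subn_eq0; case: ltngtP lerz => // [|->]; rewrite ?mulr0// binn mul1r.
under eq_bigr do rewrite bin_mul_bin natrM mulrCA.
rewrite -mulr_sumr -mulrBr normrM normr_nat bin_mul_bin natrM.
by rewrite ler_wpM2l// bonferroni0.
Qed.

Lemma exp_sum_bin (k : nat) :
  exists c : nat -> nat, forall x, (x ^ k = \sum_(i < k.+1) c i * 'C(x, i))%N.
Proof.
elim: k => [|k [c IHk]].
  by exists (fun=> 1%N) => x; rewrite big_ord1 bin0.
(* Obtained from x C(x, i) = i C(x, i) + (i + 1) C(x, i + 1): these coefficients count surjections
   onto i points. The test i <= k discards the meaningless values of c beyond k, and the factor i
   discards [c i.-1] at i = 0. *)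
exists (fun i => i * (c i * (i <= k) + c i.-1))%N => x.
have xC i : (x * 'C(x, i) = i * 'C(x, i) + i.+1 * 'C(x, i.+1))%N.
  rewrite mul_bin_left -mulnDl.
  by have [/bin_small ->|ix] := ltnP x i; rewrite ?muln0// subnKC.
rewrite expnS IHk big_distrr/=.
under eq_bigr => i _ do rewrite mulnCA xC mulnDr.
rewrite big_split/=.
under [RHS]eq_bigr => i _ do rewrite mulnDr mulnDl.
rewrite big_split/=; congr addn.
  rewrite [RHS]big_ord_recr/= ltnn !muln0 addn0.
  by apply: eq_bigr => i _; rewrite -ltnS ltn_ord muln1; ring.
rewrite [RHS]big_ord_recl/= !mul0n add0n.
by apply: eq_bigr => i _; rewrite /bump/= add1n; ring.
Qed.

(* The k-subsets of {1, ..., m} as decreasing lists, so that adding a new maximum,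
   which multiplies the probability of being sources by an explicit factor, is a cons. *)
Fixpoint decreasing_seqs (k m : nat) : seq (seq nat) :=
  match k, m with
  | 0%N, _ => [:: [::]]
  | _.+1, 0%N => [::]
  | k'.+1, m'.+1 =>
      decreasing_seqs k m' ++ map (cons m'.+1) (decreasing_seqs k' m')
  end.

Lemma decreasing_seqsP (k m : nat) (s : seq nat) : s \in decreasing_seqs k m ->
  [/\ size s = k, uniq s & all (fun v => 0 < v <= m)%N s].
Proof.
elim: m k s => [|m IHm] [|k] s //=; rewrite ?inE; try by move=> /eqP ->.
rewrite mem_cat => /orP[/IHm[-> -> s_le]|/mapP[t /IHm[szt ut t_le] ->]]; split => //=.
- by apply: sub_all s_le => v /andP[-> /leqW].
- by rewrite szt.
- rewrite ut andbT; apply/negP => /(allP t_le); lia.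
- by rewrite leqnn /=; apply: sub_all t_le => v /andP[-> /leqW].
Qed.

(** The k-subsets of the marked points are the k-subsets of [m] all of whose elements are marked;
    Pascal's rule matches the recursion of [decreasing_seqs]. *)
Lemma bin_sum_decreasing (a : pred nat) (k m : nat) :
  'C(\sum_(1 <= v < m.+1) a v, k) = (\sum_(s <- decreasing_seqs k m) all a s)%N.
Proof.
elim: m k => [|m IHm] [|k]; rewrite ?bin0 /= ?big_seq1//.
  by rewrite big_nil big_geq.
rewrite big_cat/= -IHm big_map/= big_nat_recr//=.
case: (a m.+1) => /=; last by rewrite addn0 [X in (_ + X)%N]big1 ?addn0.
by rewrite addn1 binS; congr addn; rewrite IHm.
Qed.

(** * Probability that given vertices are sources *)

Lemma prod_ratio (F : numFieldType) (m k N : nat) : (k <= m)%N ->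
  (\prod_(m.+2 <= j < m.+2 + N) ((j - k.+2)%:R / (j - k.+1)%:R)) *
    (m + N - k)%:R = (m - k)%:R :> F.
Proof.
move=> km; elim: N => [|N IHN]; first by rewrite !addn0 big_geq ?mul1r.
rewrite addnS big_nat_recr ?leq_addr//= -[RHS]IHN -mulrA.
congr (_ * _); rewrite (_ : _ - k.+1 = m + N.+1 - k)%N; last by lia.
by rewrite divfK ?pnatr_eq0; [congr (_%:R)|]; lia.
Qed.

(** The factor at j is the probability that none of the d arrows leaving j hits s: only the elements
    of s below j can be hit. *)
Definition source_weight {R : realType} (d n : nat) (s : seq nat) : R :=
  \prod_(2 <= j < n.+1) (1 - (count (fun v => v < j)%N s)%:R / j.-1%:R) ^+ d.

(** The new vertex m + 1 affects only the factors with j >= m + 2. There all k elements of s lie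
    below j, so each arrow contributes the ratio (j - k - 2) / (j - k - 1), and the product over j
    telescopes. *)
Lemma source_weight_cons (R : realType) (d n m k : nat) (s : seq nat) :
  (m < n)%N -> (k.+1 < n)%N -> s \in decreasing_seqs k m ->
  source_weight d n (m.+1 :: s) =
    ((m - k)%:R / (n - k.+1)%:R) ^+ d * source_weight d n s :> R.
Proof.
move=> mn kn /decreasing_seqsP[sz us s_le].
rewrite /source_weight (big_cat_nat (n := m.+2))//=.
rewrite [in RHS](big_cat_nat (n := m.+2))//=.
rewrite mulrCA; congr *%R.
  by apply: eq_big_nat => j jm; rewrite (_ : (m.+1 < j)%N = false) ?add0n//; lia.
(* Pigeonhole: s consists of k distinct elements of [m]. Hence the subtraction m - k is not
   truncated. *)
have km : (k <= m)%N.
  rewrite -sz -[leqRHS](size_iota 1); apply: uniq_leq_size => // v /(allP s_le).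
  by rewrite mem_iota; lia.
have cs j : (m.+1 < j)%N -> count (fun v => v < j)%N s = k.
  move=> mj; rewrite -sz; apply/eqP; rewrite -all_count.
  by apply: sub_all s_le => v; lia.
rewrite !prodrXl -exprMn; congr (_ ^+ _).
have -> : \prod_(m.+2 <= j < n.+1) (1 - (count (fun v => v < j)%N s)%:R / j.-1%:R)
    = \prod_(m.+2 <= j < n.+1) ((j - k.+1)%:R / j.-1%:R) :> R.
  apply: eq_big_nat => -[//|j] jm; rewrite cs ?subSS; last by lia.
  have j0 : j%:R != 0 :> R by rewrite pnatr_eq0; lia.
  by rewrite natrB ?mulrBl ?divff//; lia.
have -> : \prod_(m.+2 <= j < n.+1)
     (1 - ((m.+1 < j)%N + count (fun v => v < j)%N s)%:R / j.-1%:R)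
    = \prod_(m.+2 <= j < n.+1) ((j - k.+2)%:R / (j - k.+1)%:R) *
      \prod_(m.+2 <= j < n.+1) ((j - k.+1)%:R / j.-1%:R) :> R.
  rewrite -big_split/=; apply: eq_big_nat => -[//|j] jm; rewrite cs ?subSS; last by lia.
  have j0 : j%:R != 0 :> R by rewrite pnatr_eq0; lia.
  have jk : (j - k)%:R != 0 :> R by rewrite pnatr_eq0; lia.
  rewrite mulrA divfK// natrB ?mulrBl ?divff//; last by lia.
  by rewrite (_ : (m.+1 < j.+1)%N = true)//; lia.
congr *%R.
have nk : (n - k.+1)%:R != 0 :> R by rewrite pnatr_eq0; lia.
apply: (canRL (mulfK nk)).
have -> : n.+1 = (m.+2 + (n - m.+1))%N by lia.
have -> : (n - k.+1 = m + (n - m.+1) - k)%N by lia.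
exact: prod_ratio.
Qed.

Section source_probability.
Context {R : realType} {disp : measure_display} {T : measurableType disp}.
Context {P : probability T R} {d n : nat} (G : random_recursive_dag P d n).

Lemma prob_target_in (j : nat) (k : 'I_d) (s : seq nat) :
  (2 <= j <= n)%N -> uniq s -> all (fun v => 0 < v)%N s ->
  P (target G j k @^-1` [set` s]) =
    ((count (fun v => v < j)%N s)%:R / j.-1%:R)%:E.
Proof.
move=> jn; elim: s => [|v s IHs]/=.
  rewrite mul0r (_ : _ @^-1` _ = set0) ?measure0//.
  by apply/seteqP; split.
move=> /andP[vs us] /andP[v0 s0].
have -> : target G j k @^-1` [set` v :: s] =
    (target G j k @^-1` [set v]) `|` (target G j k @^-1` [set` s]).
  apply/seteqP; split => w /=; rewrite inE.
    by case/orP => [/eqP|]; [left|right].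
  by case=> [->|->]; rewrite ?eqxx ?orbT.
have mT (A : set nat) : measurable (target G j k @^-1` A).
  by rewrite -[X in measurable X]setTI; exact: measurable_funPT.
rewrite measureU//; last first.
  by apply/seteqP; split => // w [/= ->]; rewrite (negPf vs).
transitivity (((v < j)%N%:R / j.-1%:R)%:E + P (target G j k @^-1` [set` s]))%E.
  congr (_ + _)%E; have [vj|jv] := ltnP v j.
    by rewrite mul1r; apply: target_uniform; rewrite ?v0.
  rewrite mul0r (_ : _ @^-1` _ = set0) ?measure0//.
  by apply/seteqP; split => // w /= wv; have := target_range G k w jn; lia.
by rewrite IHs// -EFinD natrD mulrDl.
Qed.

(** All elements of s are sources exactly when every arrow avoids s, an intersection of independent
    events indexed by the arrows. *)
Lemma prob_all_sources (s : seq nat) :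
  uniq s -> all (fun v => 0 < v <= n)%N s ->
  P [set w | all (is_source G w) s] = (source_weight d n s)%:E.
Proof.
move=> us s_n.
have s_pos : all (fun v => 0 < v)%N s by apply: sub_all s_n => v /andP[].
pose r := [seq (j, k) | j <- index_iota 2 n.+1, k <- enum 'I_d].
pose J := seq_fset tt r.
have rP j k : ((j, k) \in r) = (2 <= j <= n)%N.
  apply/allpairsP/idP => [[[j' k'] /= [+ _ [-> _]]]|jn].
    by rewrite mem_index_iota ltnS.
  by exists (j, k); rewrite mem_index_iota ltnS jn mem_enum.
have -> : [set w | all (is_source G w) s] =
    \bigcap_(jk in [set` J]) (target G jk.1 jk.2 @^-1` (~` [set` s])).
  apply/seteqP; split => w /=.
    move=> /allP sw [j k] /=; rewrite seq_fsetE rP => jn sjk.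
    have /andP[_] := sw _ sjk.
    rewrite /in_degree (bigD1_seq j) ?mem_index_iota ?iota_uniq//=.
    by rewrite (bigD1 k)//= eqxx.
  move=> wJ; apply/allP => v vs; rewrite /is_source (allP s_n)//=.
  rewrite /in_degree big_nat big1// => j jn; rewrite big1// => k _.
  apply/eqP; rewrite eqb0; apply/eqP => jkv.
  have jkJ : (j, k) \in J by rewrite seq_fsetE rP.
  by have /= := wJ _ jkJ; rewrite jkv; apply.
rewrite (target_independent G (J := J) (B := fun=> ~` [set` s]))//; last first.
  by move=> [j k] /=; rewrite seq_fsetE rP.
congr (_%:E); rewrite (perm_big _ (seq_fset_perm tt r)) undup_id/=; last first.
  apply: allpairs_uniq; rewrite ?iota_uniq ?enum_uniq//.
  by move=> [j k] [j' k'].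
rewrite big_allpairs_dep; apply: eq_big_nat => j jn.
transitivity (\prod_(k < d) (1 - (count (fun v => v < j)%N s)%:R / j.-1%:R : R)).
  rewrite big_enum; apply: eq_bigr => k _ /=.
  have mA : measurable (target G j k @^-1` [set` s]).
    by rewrite -[X in measurable X]setTI; exact: measurable_funPT.
  rewrite preimage_setC probability_setC// prob_target_in//.
by rewrite prodr_const card_ord.
Qed.

End source_probability.

(** * Bounds on binomial moments *)

(** This bound and [exprD_le] are the mean value estimates for the power function, with the
    derivative taken at x and at x + y. They drive the inductions on power sums and on binomial
    moments. *)
Lemma exprD_ge (F : realFieldType) (x y : F) (k : nat) : 0 <= x -> 0 <= y ->
  x ^+ k.+1 + k.+1%:R * y * x ^+ k <= (x + y) ^+ k.+1.
Proof.
move=> x0 y0; elim: k => [|k IHk]; first by rewrite !expr1 expr0 mulr1 mul1r.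
rewrite [leRHS]exprS.
apply: le_trans (ler_wpM2l (addr_ge0 x0 y0) IHk).
have : 0 <= k.+1%:R * y ^+ 2 * x ^+ k by rewrite !mulr_ge0 ?exprn_ge0.
by rewrite -(natr1 k.+1) !exprS expr0; nra.
Qed.

Lemma exprD_le (F : realFieldType) (x y : F) (k : nat) : 0 <= x -> 0 <= y ->
  (x + y) ^+ k.+1 <= x ^+ k.+1 + k.+1%:R * y * (x + y) ^+ k.
Proof.
move=> x0 y0; elim: k => [|k IHk]; first by rewrite !expr1 expr0 mulr1 mul1r.
rewrite [leLHS]exprS mulrDl.
apply: le_trans (_ : x * (x ^+ k.+1 + k.+1%:R * y * (x + y) ^+ k) + y * (x + y) ^+ k.+1 <= _).
  by rewrite lerD2r ler_wpM2l.
have : x * (k.+1%:R * y * (x + y) ^+ k) <= (x + y) * (k.+1%:R * y * (x + y) ^+ k).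
  by rewrite ler_wpM2r ?lerDl// !mulr_ge0 ?exprn_ge0 ?addr_ge0.
by rewrite -(natr1 k.+1) !exprS; nra.
Qed.

Definition power_sum {R : pzSemiRingType} (d m : nat) : R :=
  \sum_(1 <= v < m.+1) v%:R ^+ d.

Lemma power_sum0 (R : pzSemiRingType) (d : nat) : power_sum d 0 = 0 :> R.
Proof. by rewrite /power_sum big_geq. Qed.

Lemma power_sumS (R : pzSemiRingType) (d m : nat) :
  power_sum d m.+1 = power_sum d m + m.+1%:R ^+ d :> R.
Proof. by rewrite /power_sum big_nat_recr. Qed.

Lemma power_sum_ge0 (R : numDomainType) (d m : nat) : 0 <= power_sum d m :> R.
Proof. by apply: sumr_ge0 => v _; rewrite exprn_ge0. Qed.

(** A discrete form of comparing the sum with the integral of t^d; likewise for [power_sum_ge]. *)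
Lemma power_sum_le (R : realFieldType) (d m : nat) :
  d.+1%:R * power_sum d m <= m.+1%:R ^+ d.+1 :> R.
Proof.
elim: m => [|m IHm]; first by rewrite power_sum0 mulr0.
rewrite power_sumS mulrDr; apply: le_trans (lerD IHm (lexx _)) _.
have := @exprD_ge R m.+1%:R 1 d (ler0n _ _) ler01.
by rewrite mulr1 natr1.
Qed.

Lemma power_sum_ge (R : realFieldType) (d m : nat) :
  m%:R ^+ d.+1 <= d.+1%:R * power_sum d m :> R.
Proof.
elim: m => [|m IHm]; first by rewrite power_sum0 mulr0 expr0n.
rewrite power_sumS mulrDr; apply: le_trans (lerD IHm (lexx _)).
have := @exprD_le R m%:R 1 d (ler0n _ _) ler01.
by rewrite mulr1 natr1.
Qed.

(** A closed form for the k-th binomial moment of the number of sources in [m], valid for m <= n by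
    [expectation_binE]. *)
Definition bin_moment {R : realType} (d n k m : nat) : R :=
  \sum_(s <- decreasing_seqs k m) source_weight d n s.

Section bin_moment.
Context {R : realType} (d n : nat).

Lemma bin_moment0 (m : nat) : bin_moment d n 0 m = 1 :> R.
Proof.
rewrite /bin_moment; case: m => [|m]; rewrite /= big_seq1 /source_weight;
by rewrite big1// => j _; rewrite mul0r subr0 expr1n.
Qed.

Lemma bin_moment_S0 (k : nat) : bin_moment d n k.+1 0 = 0 :> R.
Proof. by rewrite /bin_moment big_nil. Qed.

(** The (k + 1)-subsets of [m + 1] are split by whether they contain m + 1. The factor this vertex
    brings depends on the rest of the subset only through its size, so it leaves the sum. *)
Lemma bin_momentSS (k m : nat) : (m < n)%N -> (k.+1 < n)%N ->
  bin_moment d n k.+1 m.+1 =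
    bin_moment d n k.+1 m + ((m - k)%:R / (n - k.+1)%:R) ^+ d * bin_moment d n k m :> R.
Proof.
move=> mn kn; rewrite /bin_moment/= big_cat big_map/=; congr +%R.
rewrite mulr_sumr big_seq [RHS]big_seq; apply: eq_bigr => s.
exact: source_weight_cons.
Qed.

Lemma bin_moment_ge0 (k m : nat) : (m <= n)%N -> (k < n)%N -> 0 <= bin_moment d n k m :> R.
Proof.
elim: m k => [|m IHm] [|k] mn kn; rewrite ?bin_moment0 ?bin_moment_S0//.
by rewrite bin_momentSS// addr_ge0 ?mulr_ge0 ?exprn_ge0 ?IHm//; lia.
Qed.

(** Fixing K while k decreases keeps the denominator constant through the induction. The recursion
    then closes by x^(k+1) + (k + 1) y x^k <= (x + y)^(k+1), where y is the increment of x. *)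
Lemma bin_moment_le (K k m : nat) : (m <= n)%N -> (k <= K)%N -> (K < n)%N ->
  bin_moment d n k m <= (power_sum d m / (n - K)%:R ^+ d) ^+ k / k`!%:R :> R.
Proof.
move=> + + Kn; elim: m k => [|m IHm] [|k] mn kK.
- by rewrite bin_moment0 expr0 fact0 divr1.
- by rewrite bin_moment_S0 power_sum0 mul0r expr0n mul0r.
- by rewrite bin_moment0 expr0 fact0 divr1.
rewrite bin_momentSS//; last exact: leq_ltn_trans Kn.
set x := power_sum d m / (n - K)%:R ^+ d : R.
set y := m.+1%:R ^+ d / (n - K)%:R ^+ d : R.
have x0 : 0 <= x by rewrite divr_ge0 ?exprn_ge0 ?power_sum_ge0.
have y0 : 0 <= y by rewrite divr_ge0 ?exprn_ge0.
have nK : 0 < (n - K)%:R :> R by rewrite ltr0n subn_gt0.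
have step : ((m - k)%:R / (n - k.+1)%:R) ^+ d * bin_moment d n k m <= y * (x ^+ k / k`!%:R).
  apply: ler_pM; rewrite ?exprn_ge0 ?divr_ge0 ?bin_moment_ge0 ?IHm//; try by lia.
  rewrite /y -expr_div_n; apply: lerXn2r; rewrite ?nnegrE ?divr_ge0//.
  apply: ler_pM; rewrite ?invr_ge0 ?ler_nat//; first by lia.
  by rewrite lef_pV2 ?posrE// ?ltr0n ?ler_nat; lia.
apply: le_trans (lerD (IHm _ _ _) step) _; [by lia|by []|].
rewrite power_sumS mulrDl -/x -/y.
apply: le_trans (_ : (x ^+ k.+1 + k.+1%:R * y * x ^+ k) / k.+1`!%:R <= _).
  rewrite factS natrM le_eqVlt; apply/orP; left; apply/eqP; rewrite -/x; field.
  by rewrite nat1r !pnatr_eq0 -lt0n fact_gt0.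
by rewrite ler_wpM2r ?invr_ge0// exprD_ge.
Qed.

(** The recursion factor is at least ((m - k) / n)^d. The shift by k makes the two induction
    hypotheses speak of x and x + y, as [exprD_le] requires; for m <= k with k > 0 the bound is
    0. *)
Lemma bin_moment_ge (k m : nat) : (m <= n)%N -> (k < n)%N ->
  (power_sum d (m - k) / n%:R ^+ d) ^+ k / k`!%:R <= bin_moment d n k m :> R.
Proof.
elim: m k => [|m IHm] [|k] mn kn.
- by rewrite bin_moment0 expr0 fact0 divr1.
- by rewrite bin_moment_S0 power_sum0 mul0r expr0n mul0r.
- by rewrite bin_moment0 expr0 fact0 divr1.
rewrite subSS; have [mk|km] := leqP m k.
  rewrite (eqP (mk : (m - k == 0)%N)) power_sum0 mul0r expr0n mul0r.
  exact: bin_moment_ge0.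
rewrite bin_momentSS//.
set x := power_sum d (m - k.+1) / n%:R ^+ d : R.
set y := (m - k)%:R ^+ d / n%:R ^+ d : R.
have mkE : (m - k = (m - k.+1).+1)%N by lia.
have xy : power_sum d (m - k) / n%:R ^+ d = x + y.
  by rewrite mkE power_sumS mulrDl -mkE.
have x0 : 0 <= x by rewrite divr_ge0 ?exprn_ge0 ?power_sum_ge0.
have y0 : 0 <= y by rewrite divr_ge0 ?exprn_ge0.
have step : y * ((x + y) ^+ k / k`!%:R) <= ((m - k)%:R / (n - k.+1)%:R) ^+ d * bin_moment d n k m.
  apply: ler_pM; rewrite ?mulr_ge0 ?invr_ge0 ?exprn_ge0 ?addr_ge0//.
    rewrite /y -expr_div_n; apply: lerXn2r; rewrite ?nnegrE ?divr_ge0//.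
    by rewrite ler_wpM2l// lef_pV2 ?posrE ?ltr0n ?ler_nat; lia.
  by rewrite -xy IHm//; lia.
apply: le_trans (lerD (IHm _ _ _) step); [|by lia|by []].
rewrite -/x xy.
apply: le_trans (_ : (x ^+ k.+1 + k.+1%:R * y * (x + y) ^+ k) / k.+1`!%:R <= _).
  by rewrite ler_wpM2r ?invr_ge0// exprD_le.
rewrite factS natrM le_eqVlt; apply/orP; left; apply/eqP; field.
by rewrite nat1r !pnatr_eq0 -lt0n fact_gt0.
Qed.

End bin_moment.

(** * Binomial moments of the number of sources *)

Section factorial_moments.
Context {R : realType} {disp : measure_display} {T : measurableType disp}.
Context {P : probability T R} {d n : nat} (G : random_recursive_dag P d n).

(** The natural-number version of [num_sources], to which binomial coefficients apply. *)
Definition source_count (m : nat) (w : T) : nat :=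
  (\sum_(1 <= v < m.+1) is_source G w v)%N.

Lemma num_sourcesE (m : nat) (w : T) :
  num_sources G m w = (source_count m w)%:R.
Proof. by rewrite /num_sources natr_sum. Qed.

Lemma measurable_source_count (m : nat) :
  measurable_fun [set: T] (source_count m).
Proof.
move=> _ A _; rewrite setTI.
have -> : source_count m @^-1` A =
    \bigcup_(k in A) (num_sources G m @^-1` [set k%:R]).
  apply/seteqP; split => w /=.
    by move=> Aw; exists (source_count m w) => //=; rewrite num_sourcesE.
  by move=> [k Ak] /=; rewrite num_sourcesE => /(mulrIn (oner_neq0 _)) ->.
apply: bigcup_measurable => k _; rewrite -[X in measurable X]setTI.
exact: measurable_num_sources.
Qed.

HB.instance Definition _ (m : nat) :=
  isMeasurableFun.Build _ _ _ _ (source_count m) (measurable_source_count m).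

Lemma measurable_all_sources (s : seq nat) :
  measurable [set w | all (is_source G w) s].
Proof.
elim: s => [|v s IHs] /=.
  by rewrite (_ : mkset _ = setT)//; apply/seteqP; split.
rewrite (_ : mkset _ = (is_source G ^~ v @^-1` [set true]) `&`
   [set w | all (is_source G w) s]).
  apply: measurableI => //; rewrite -[X in measurable X]setTI.
  exact: measurable_is_source.
by apply/seteqP; split => w /= => [/andP//|[-> ->]].
Qed.

(** By [bin_sum_decreasing] the integrand is a sum of indicators over the k-subsets of [m]. *)
Lemma expectation_bin_source_count (m k : nat) :
  ('E_P[fun w => 'C(source_count m w, k)%:R] =
    \sum_(s <- decreasing_seqs k m) P [set w | all (is_source G w) s])%E.
Proof.
rewrite unlock.
under eq_integral => w _ do
  rewrite /source_count bin_sum_decreasing natr_sum -sumEFin.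
have allE s : (fun w => (all (is_source G w) s)%:R) =
    \1_[set w | all (is_source G w) s] :> (T -> R).
  by apply/funext => w; rewrite indicE; congr ((nat_of_bool _)%:R); apply/idP/idP; rewrite inE.
rewrite ge0_integral_sum//; last first.
  move=> s; apply/measurable_EFinP; rewrite allE.
  exact/measurable_indic/measurable_all_sources.
apply: eq_bigr => s _; rewrite -[RHS]expectation_indic; last exact: measurable_all_sources.
by rewrite unlock -allE.
Qed.

Lemma expectation_bin_source_count_fin_num (m k : nat) :
  'E_P[fun w => 'C(source_count m w, k)%:R]%E \is a fin_num.
Proof.
rewrite expectation_bin_source_count; apply/sum_fin_numP => s _ _.
exact/fin_num_measure/measurable_all_sources.
Qed.

Lemma expectation_binE (m k : nat) : (m <= n)%N ->
  ('E_P[fun w => 'C(source_count m w, k)%:R] = (bin_moment d n k m)%:E)%E.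
Proof.
move=> mn; rewrite expectation_bin_source_count -sumEFin.
rewrite big_seq [RHS]big_seq; apply: eq_bigr => s /decreasing_seqsP[_ us s_le].
by rewrite prob_all_sources//; apply: sub_all s_le => v; lia.
Qed.

End factorial_moments.

(** * Method of binomial moments *)

Lemma cvg_sumr {R : numFieldType} {I U : Type} (F : set_system U) {FF : Filter F}
    (s : seq I) (f : I -> U -> R) (l : I -> R) :
  (forall i, f i x @[x --> F] --> l i) ->
  \sum_(i <- s) f i x @[x --> F] --> \sum_(i <- s) l i.
Proof. by move=> fl; apply: cvg_big => //; exact: add_continuous. Qed.

Lemma Rintegral_sum {R : realType} {disp : measure_display}
    {T : measurableType disp} (mu : {measure set T -> \bar R})
    (D : set T) (I : Type) (s : seq I) (f : I -> T -> R) : measurable D ->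
  (forall i, mu.-integrable D (EFin \o f i)) ->
  \int[mu]_(x in D) (\sum_(i <- s) f i x) = \sum_(i <- s) \int[mu]_(x in D) f i x.
Proof.
move=> mD intf; elim: s => [|i s IHs].
  under eq_Rintegral do rewrite big_nil.
  by rewrite big_nil /Rintegral integral0.
under eq_Rintegral do rewrite big_cons.
rewrite big_cons -IHs RintegralD//.
rewrite (_ : _ \o _ = fun x => (\sum_(i <- s) (EFin \o f i) x)%E).
  exact: integrable_sum.
by apply/funext => x /=; rewrite sumEFin.
Qed.

Section nat_valued.
Context {R : realType} {disp : measure_display} {T : measurableType disp}.
Context (P : probability T R) (X : {mfun T >-> nat}).

Lemma measurable_nat_comp (f : nat -> R) : measurable_fun [set: T] (fun w => f (X w)).
Proof.
have mf : measurable_fun [set: nat] f by [].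
exact: (measurableT_comp mf).
Qed.

Lemma measurable_preimage_nat (A : set nat) : measurable (X @^-1` A).
Proof. by rewrite -[X in measurable X]setTI; exact: measurable_funPT. Qed.

Lemma integrable_nat_comp (f : nat -> R) : (forall x, 0 <= f x) ->
  'E_P[fun w => f (X w)]%E \is a fin_num ->
  P.-integrable [set: T] (EFin \o (fun w => f (X w))).
Proof.
move=> f0; rewrite unlock ge0_fin_numE; last first.
  by apply: integral_ge0 => w _; rewrite lee_fin.
move=> Efin; apply/integrableP; split.
  exact/measurable_EFinP/measurable_nat_comp.
by under eq_integral => w _ do rewrite /= ger0_norm//.
Qed.

(** The pointwise inequality [bonferroni] integrated; finite binomial moments make each term
    integrable. *)
Lemma bonferroni_prob (r s : nat) :
  (forall j, 'E_P[fun w => 'C(X w, j)%:R]%E \is a fin_num) ->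
  `|fine (P (X @^-1` [set r])) -
    \sum_(i < s) (-1) ^+ i * 'C(r + i, r)%:R *
      fine 'E_P[fun w => 'C(X w, r + i)%:R]%E|
  <= 'C(r + s, r)%:R * fine 'E_P[fun w => 'C(X w, r + s)%:R]%E.
Proof.
move=> Efin.
have intC j : P.-integrable [set: T] (EFin \o (fun w => 'C(X w, j)%:R : R)).
  exact: (@integrable_nat_comp (fun x => 'C(x, j)%:R)).
have intcC (c : R) j : P.-integrable [set: T] (EFin \o (fun w => c * 'C(X w, j)%:R)).
  by have := integrableZl measurableT c (intC j).
have EZ (c : R) j : \int[P]_w (c * 'C(X w, j)%:R) =
    c * fine 'E_P[fun w => 'C(X w, j)%:R]%E.
  by rewrite RintegralZl// /Rintegral unlock.
have Er : ('E_P[fun w => (X w == r)%:R] = P (X @^-1` [set r]))%E.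
  rewrite -expectation_indic; last exact: measurable_preimage_nat.
  congr expectation; apply/funext => w; rewrite indicE; congr (nat_of_bool _)%:R.
  by apply/eqP/idP; rewrite inE.
have PE : fine (P (X @^-1` [set r])) = \int[P]_w (X w == r)%:R.
  by rewrite -Er unlock.
have intr : P.-integrable [set: T] (EFin \o (fun w => (X w == r)%:R : R)).
  apply: (@integrable_nat_comp (fun x => (x == r)%:R)) => //.
  by rewrite Er; exact/fin_num_measure/measurable_preimage_nat.
have intsum : P.-integrable [set: T] (EFin \o
    (fun w => \sum_(i < s) (-1) ^+ i * 'C(r + i, r)%:R * 'C(X w, r + i)%:R)).
  rewrite (_ : _ \o _ = fun w => (\sum_(i < s)
      ((-1) ^+ i * 'C(r + i, r)%:R * 'C(X w, r + i)%:R)%:E)%E).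
    by apply: integrable_sum => // i _; exact: (intcC ((-1) ^+ i * 'C(r + i, r)%:R) (r + i)%N).
  by apply/funext => w /=; rewrite sumEFin.
under eq_bigr do rewrite -EZ.
rewrite -Rintegral_sum// PE -RintegralB// -EZ.
apply: le_trans (le_normr_Rintegral _ _) _ => //.
  exact: (integrableB measurableT intr intsum).
apply: le_Rintegral => //.
- by have := integrable_abse (integrableB measurableT intr intsum).
- move=> w _; rewrite -natrM.
  under eq_bigr do rewrite -mulrA -natrM.
  exact: bonferroni.
Qed.

(** Writing the cdf as a finite sum of point masses reduces its convergence to that of each point
    mass. *)
Lemma le_prob_cdf_nat (x : R) : 0 <= x ->
  fine (P [set w | (X w)%:R <= x]) =
    \sum_(r < (Num.truncn x).+1) fine (P (X @^-1` [set nat_of_ord r])).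
Proof.
move=> x0.
have -> : [set w | (X w)%:R <= x] =
    \big[setU/set0]_(r < (Num.truncn x).+1) (X @^-1` [set nat_of_ord r]).
  apply/seteqP; split => w; rewrite -(bigcup_mkord _ (fun r => X @^-1` [set r])).
    move=> /= Xx; exists (X w) => //=; rewrite ltnS.
    by rewrite truncn_ge_nat.
  by move=> [r /= rx ->]; rewrite -truncn_ge_nat.
rewrite (measure_bigsetU P (F := fun r => X @^-1` [set r]))//; first last.
- apply/trivIsetP => i j _ _ ij; apply/seteqP; split => // w /= [-> ji].
  by move: ij; rewrite ji eqxx.
- by move=> i; exact: measurable_preimage_nat.
rewrite sum_fine//.
by move=> i _; exact/fin_num_measure/measurable_preimage_nat.
Qed.

Lemma expectation_nat_exp (k : nat) (c : nat -> nat) :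
  (forall x, x ^ k = \sum_(i < k.+1) c i * 'C(x, i))%N ->
  ('E_P[fun w => ((X w)%:R ^+ k)%R] =
    \sum_(i < k.+1) ((c i)%:R)%R%:E * 'E_P[fun w => ('C(X w, i)%:R)%R])%E.
Proof.
move=> xk; rewrite unlock.
under eq_integral => w _ do rewrite -natrX xk natr_sum -sumEFin.
rewrite ge0_integral_sum//; last first.
  move=> i; apply/measurable_EFinP.
  exact: (measurable_nat_comp (fun x => (c i * 'C(x, i))%:R)).
apply: eq_bigr => i _; under eq_integral => w _ do rewrite natrM EFinM.
rewrite ge0_integralZl_EFin//.
by apply/measurable_EFinP; exact: (measurable_nat_comp (fun x => 'C(x, i)%:R)).
Qed.

End nat_valued.

Section moment_method.
Context {R : realType} {disp : nat -> measure_display}.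
Context {T : forall n, measurableType (disp n)} (P : forall n, probability (T n) R).
Context (X : forall n, {mfun T n >-> nat}).
Context {disp' : measure_display} {T' : measurableType disp'}.
Context (Q : probability T' R) (Y : {mfun T' >-> nat}).
Hypothesis X_fin : forall n j, 'E_(P n)[fun w => 'C(X n w, j)%:R]%E \is a fin_num.
Hypothesis Y_fin : forall j, 'E_Q[fun w => 'C(Y w, j)%:R]%E \is a fin_num.
Hypothesis cvgX : forall j,
  ('E_(P n)[fun w => 'C(X n w, j)%:R] @[n --> \oo] --> 'E_Q[fun w => 'C(Y w, j)%:R])%E.

(** The Bonferroni truncation level s is chosen from Y alone. With s fixed, both the truncated sum
    and the error bound for X n involve finitely many binomial moments, which converge. *)
Lemma cvg_pmf_of_bin_moments (r : nat) :
  'C(r + s, r)%:R * fine 'E_Q[fun w => 'C(Y w, r + s)%:R]%E @[s --> \oo] --> (0 : R) ->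
  fine (P n (X n @^-1` [set r])) @[n --> \oo] --> fine (Q (Y @^-1` [set r])).
Proof.
move=> Y0.
have cvgXr j : fine 'E_(P n)[fun w => 'C(X n w, j)%:R]%E @[n --> \oo] -->
    fine 'E_Q[fun w => 'C(Y w, j)%:R]%E.
  by apply: fine_cvg; rewrite fineK.
apply/cvgrPdist_le => e e0.
(* The error for Y and the distance of the truncated sums cost e / 4 each. The error for X n is
   within e / 4 of the bound for Y, hence at most e / 2. *)
have e4 : 0 < e / 4 by lra.
have [s _ /(_ s (leqnn s)) sP] := (cvgr0Pnorm_le _).1 Y0 _ e4.
pose S n := \sum_(i < s) (-1) ^+ i * 'C(r + i, r)%:R *
      fine 'E_(P n)[fun w => 'C(X n w, r + i)%:R]%E.
pose S' := \sum_(i < s) (-1) ^+ i * 'C(r + i, r)%:R *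
      fine 'E_Q[fun w => 'C(Y w, r + i)%:R]%E.
have cvgS : S n @[n --> \oo] --> S'.
  apply: cvg_sumr => i; apply: cvgMr; exact: cvgXr.
pose b n := 'C(r + s, r)%:R * fine 'E_(P n)[fun w => 'C(X n w, r + s)%:R]%E.
pose b' := 'C(r + s, r)%:R * fine 'E_Q[fun w => 'C(Y w, r + s)%:R]%E.
have cvgb : b n @[n --> \oo] --> b' by apply: cvgMr; exact: cvgXr.
have nS : \forall n \near \oo, `|S' - S n| <= e / 4 by move/cvgrPdist_le: cvgS; apply.
have nb : \forall n \near \oo, `|b' - b n| <= e / 4 by move/cvgrPdist_le: cvgb; apply.
near=> n.
have h1 := bonferroni_prob (P n) (X n) r s (X_fin n).
have h2 := bonferroni_prob Q Y r s Y_fin.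
have h3 : `|S' - S n| <= e / 4 by near: n.
have h4 : `|b' - b n| <= e / 4 by near: n.
rewrite -/(S n) -/(b n) in h1; rewrite -/S' -/b' in h2 sP.
move: h1 h2 h3 h4 sP; rewrite !ler_norml => /andP[? ?] /andP[? ?] /andP[? ?] /andP[? ?] /andP[? ?].
by apply/andP; split; lra.
Unshelve. all: by end_near. Qed.

End moment_method.

(** * Poisson distribution *)

Lemma ge0_integral_nat {R : realType} (mu : {measure set nat -> \bar R})
    (f : nat -> \bar R) : (forall k, 0 <= f k)%E ->
  (\int[mu]_k f k = \sum_(k <oo) f k * mu [set k])%E.
Proof.
move=> f0.
have -> : [set: nat] = \bigcup_k [set k].
  by apply/seteqP; split => // k _; exists k.
rewrite ge0_integral_bigcup//; last first.
  apply/trivIsetP => i j _ _ ij; apply/seteqP; split => // k [/= -> ji].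
  by move: ij; rewrite ji eqxx.
apply: eq_eseriesr => k _.
rewrite (eq_integral (cst (f k))); last by move=> i; rewrite inE => ->.
by rewrite integral_cst.
Qed.

Lemma Poi_set1 {R : realType} (lambda : R) (k : nat) : 0 < lambda ->
  Poi lambda [set k] = (poisson_pmf lambda k)%:E.
Proof.
move=> l0; rewrite /Poi/= /poisson_prob l0 esum_set1//.
by rewrite lee_fin poisson_pmf_ge0.
Qed.

(** Terms with k < j vanish, and shifting the index by j turns the others into lambda^j / j! times
    the Poisson weights, which sum to 1. *)
Lemma expectation_bin_Poi {R : realType} (lambda : R) (j : nat) : 0 < lambda ->
  ('E_(Poi lambda)[fun k => ('C(k, j)%:R)%R] = (lambda ^+ j / j`!%:R)%:E)%E.
Proof.
move=> l0; rewrite unlock ge0_integral_nat; last by move=> k; rewrite lee_fin.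
apply: cvg_lim => //; rewrite -(cvg_shiftn j).
have pmfj i : 'C(i + j, j)%:R * poisson_pmf lambda (i + j) =
    lambda ^+ j / j`!%:R * poisson_pmf lambda i.
  rewrite /poisson_pmf l0 exprD.
  have /(congr1 (fun n => n%:R : R)) := bin_fact (leq_addl i j).
  rewrite addnK !natrM => Cij.
  have ifact k : k`!%:R != 0 :> R by rewrite pnatr_eq0 -lt0n fact_gt0.
  have C0 : 'C(i + j, j)%:R != 0 :> R by rewrite pnatr_eq0 -lt0n bin_gt0 leq_addl.
  by rewrite -Cij; field; rewrite !ifact C0.
rewrite (_ : [sequence _]_n = fun n => ((lambda ^+ j / j`!%:R)%:E *
    \sum_(0 <= i < n) (poisson_pmf lambda i)%:E)%E); last first.
  apply/funext => n /=.
  rewrite (big_cat_nat (n := j)) ?leq_addl//= [X in (X + _)%E]big_nat.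
  rewrite [X in (X + _)%E]big1 => [|i ij]; last by rewrite bin_small ?mul0e.
  rewrite add0e -{1}[j]add0n big_addn addnK ge0_sume_distrr; last first.
    by move=> i _; rewrite lee_fin poisson_pmf_ge0.
  by apply: eq_bigr => i _; rewrite Poi_set1// -!EFinM pmfj.
have cvg1 : (\sum_(0 <= i < n) (poisson_pmf lambda i)%:E)%E @[n --> \oo] --> (1 : \bar R)%E.
  have -> : 1%E = (\sum_(0 <= i <oo) (poisson_pmf lambda i)%:E)%E.
    rewrite -(probability_setT (Poi lambda)) -[LHS]mul1e -integral_cst//.
    rewrite ge0_integral_nat//; apply: eq_eseriesr => i _.
    by rewrite mul1e; apply: Poi_set1.
  by apply: is_cvg_nneseries => i _ _; rewrite lee_fin poisson_pmf_ge0.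
have cfin : (lambda ^+ j / j`!%:R)%:E \is a fin_num by [].
by have := cvgeZl cfin cvg1; rewrite mule1.
Qed.

(** * Asymptotics at the threshold *)

Lemma cvg_exprn {R : realType} {U : Type} (F : set_system U) {FF : Filter F}
    (k : nat) (f : U -> R) (l : R) :
  f u @[u --> F] --> l -> f u ^+ k @[u --> F] --> l ^+ k.
Proof. by move=> fl; exact: (continuous_cvg _ (@exprn_continuous R k l) fl). Qed.

Definition threshold {R : realType} (d n : nat) : R := n%:R `^ (d%:R / d.+1%:R).

Section threshold.
Context {R : realType} (d : nat).
Hypothesis d_gt0 : (0 < d)%N.

(** This identity explains the exponent: it turns m^(d+1) / n^d into the (d + 1)-st power of m over
    the threshold. *)
Lemma threshold_exp (n : nat) : threshold d n ^+ d.+1 = n%:R ^+ d :> R.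
Proof. by rewrite /threshold -powR_mulrn ?powR_ge0// -powRrM divfK// powR_mulrn. Qed.

Lemma threshold_ge0 (n : nat) : 0 <= threshold d n :> R.
Proof. exact: powR_ge0. Qed.

Lemma threshold_gt0 (n : nat) : (0 < n)%N -> 0 < threshold d n :> R.
Proof. by move=> n0; rewrite powR_gt0 ?ltr0n. Qed.

Lemma near_le_nat (A : R) : \forall n \near \oo, A <= n%:R.
Proof. by apply: nbhs_infty_ger. Qed.

Lemma cvg_threshold : (threshold d n : R) @[n --> \oo] --> +oo.
Proof.
apply/cvgryPge => A; near=> n; rewrite leNgt; apply/negP => xA.
have n0 : (0 < n)%N by near: n; exact: nbhs_infty_gt.
have : `|A| ^+ d.+1 <= n%:R by near: n; exact: near_le_nat.
apply/negP; rewrite -ltNge.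
(* Since d > 0, n <= n^d, the (d + 1)-st power of the threshold. If the threshold stayed below A, n
   would be below |A|^(d+1). *)
apply: (@le_lt_trans _ _ (threshold d n ^+ d.+1)).
  rewrite threshold_exp -natrX ler_nat -[leqLHS]expn1.
  exact: leq_pexp2l.
by rewrite ltrXn2r ?nnegrE ?threshold_ge0// (lt_le_trans xA)// ler_norm.
Unshelve. all: by end_near. Qed.

Lemma cvg_thresholdV (c : R) : c / threshold d n @[n --> \oo] --> 0.
Proof.
rewrite -[X in _ --> X](mulr0 c); apply: cvgMr.
apply/gtr0_cvgV0; last exact: cvg_threshold.
by near=> n; apply: threshold_gt0; near: n; exact: nbhs_infty_gt.
Unshelve. all: by end_near. Qed.

Lemma cvg_ratio (k : nat) : n%:R / (n - k)%:R @[n --> \oo] --> (1 : R).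
Proof.
rewrite -(cvg_shiftn k.+1).
rewrite (_ : [sequence _]_n = fun n => 1 + k%:R * harmonic n); last first.
  apply/funext => n /=; rewrite (_ : n + k.+1 - k = n.+1)%N; last by lia.
  rewrite (_ : n + k.+1 = n.+1 + k)%N; last by lia.
  by rewrite natrD mulrDl divff ?pnatr_eq0.
have h : 1 + k%:R * harmonic n @[n --> \oo] --> (1 + k%:R * 0 : R).
  by apply: cvgD; [exact: cvg_cst|apply: cvgMr; exact: cvg_harmonic].
by rewrite mulr0 addr0 in h.
Qed.

Section asymptotics.
Variables (M : R) (m : nat -> nat).
Hypothesis cvg_m : (m n)%:R / threshold d n @[n --> \oo] --> M.

(** Eventually m is at most |M| + 1 times the threshold. Then n < m would give n^(d+1) < (|M| +
    1)^(d+1) n^d, bounding n. *)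
Lemma near_le_of_threshold : \forall n \near \oo, (m n <= n)%N.
Proof.
near=> n; rewrite leqNgt; apply/negP => nm.
have n0 : (0 < n)%N by near: n; exact: nbhs_infty_gt.
have : (`|M| + 1) ^+ d.+1 <= n%:R by near: n; exact: near_le_nat.
apply/negP; rewrite -ltNge.
have mx : (m n)%:R <= (`|M| + 1) * threshold d n.
  rewrite -ler_pdivrMr ?threshold_gt0//.
  have : `|M - (m n)%:R / threshold d n| <= 1.
    by near: n; move/cvgrPdist_le: cvg_m; apply.
  rewrite ler_norml => /andP[+ _]; have := ler_norm M; lra.
have n0R : 0 < n%:R ^+ d :> R by rewrite exprn_gt0// ltr0n.
rewrite -(ltr_pM2r n0R) -exprS -threshold_exp -exprMn.
apply: lt_le_trans (_ : (m n)%:R ^+ d.+1 <= _).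
  by rewrite ltrXn2r ?nnegrE// ltr_nat.
by rewrite lerXn2r ?nnegrE// mulr_ge0 ?addr_ge0 ?threshold_ge0.
Unshelve. all: by end_near. Qed.

Lemma cvg_succ_threshold : (m n).+1%:R / threshold d n @[n --> \oo] --> M.
Proof.
rewrite -[X in _ --> X]addr0.
under eq_fun do rewrite -natr1 mulrDl.
by apply: cvgD => //; exact: cvg_thresholdV.
Qed.

Lemma cvg_sub_threshold (k : nat) : (m n - k)%:R / threshold d n @[n --> \oo] --> M.
Proof.
apply: (@squeeze_cvgr _ _ _ _ (fun n => (m n)%:R / threshold d n - k%:R / threshold d n)
  (fun n => (m n)%:R / threshold d n)) => //.
  near=> n; rewrite -mulrBl; have x0 := threshold_ge0 n.
  rewrite !ler_wpM2r ?invr_ge0 ?ler_nat ?leq_subr//.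
  by rewrite lerBlDr -natrD ler_nat; lia.
by rewrite -[X in _ --> X]subr0; apply: cvgB => //; exact: cvg_thresholdV.
Unshelve. all: by end_near. Qed.

(** Squeeze between [bin_moment_ge] and [bin_moment_le] with K = k, after bounding the power sums.
    The factor (n / (n - k))^d converts the denominator (n - k)^d of the upper bound into n^d. *)
Lemma cvg_bin_moment (k : nat) :
  bin_moment d n k (m n) @[n --> \oo] -->
    (M ^+ d.+1 / d.+1%:R) ^+ k / k`!%:R.
Proof.
apply: (@squeeze_cvgr _ _ _ _
  (fun n => (((m n - k)%:R / threshold d n) ^+ d.+1 / d.+1%:R) ^+ k / k`!%:R)
  (fun n => (((m n).+1%:R / threshold d n) ^+ d.+1 / d.+1%:R * (n%:R / (n - k)%:R) ^+ d) ^+ k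
      / k`!%:R)).
- near=> n.
  have mn : (m n <= n)%N by near: n; exact: near_le_of_threshold.
  have kn : (k < n)%N by near: n; exact: nbhs_infty_gt.
  have n0 : n%:R != 0 :> R by rewrite pnatr_eq0; lia.
  have nk0 : (n - k)%:R != 0 :> R by rewrite pnatr_eq0; lia.
  have d0 : d.+1%:R != 0 :> R by rewrite pnatr_eq0.
  apply/andP; split.
    apply: le_trans (bin_moment_ge _ _ _ _ mn kn).
    rewrite ler_wpM2r ?invr_ge0// lerXn2r ?nnegrE//.
    + by rewrite !(divr_ge0, exprn_ge0) ?threshold_ge0.
    + by rewrite divr_ge0 ?exprn_ge0 ?power_sum_ge0.
    rewrite expr_div_n threshold_exp mulrAC ler_wpM2r ?invr_ge0 ?exprn_ge0//.
    by rewrite ler_pdivrMr ?ltr0n// mulrC power_sum_ge.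
  apply: le_trans (bin_moment_le _ _ _ _ _ mn (leqnn k) kn) _.
  rewrite ler_wpM2r ?invr_ge0// lerXn2r ?nnegrE//.
  + by rewrite divr_ge0 ?exprn_ge0 ?power_sum_ge0.
  + by rewrite mulr_ge0 ?divr_ge0 ?exprn_ge0 ?divr_ge0 ?threshold_ge0.
  rewrite !expr_div_n threshold_exp.
  rewrite (_ : _ * (_ / _) = (m n).+1%:R ^+ d.+1 / d.+1%:R / (n - k)%:R ^+ d); last first.
    by field; rewrite nat1r d0 !expf_neq0.
  rewrite ler_wpM2r ?invr_ge0 ?exprn_ge0//.
  by rewrite ler_pdivlMr ?ltr0n// mulrC power_sum_le.
- apply: cvgMl; apply: cvg_exprn; apply: cvgMl; apply: cvg_exprn.
  exact: cvg_sub_threshold.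
- apply: cvgMl; apply: cvg_exprn.
  rewrite -[X in _ --> X]mulr1; apply: cvgM.
    by apply: cvgMl; apply: cvg_exprn; exact: cvg_succ_threshold.
  have h := cvg_exprn _ d _ _ (cvg_ratio k).
  by rewrite expr1n in h; exact: h.
Unshelve. all: by end_near. Qed.

End asymptotics.

Lemma cvg_truncn_threshold (M : R) : 0 < M ->
  (Num.truncn (M * threshold d n))%:R / threshold d n @[n --> \oo] --> M.
Proof.
move=> M0.
apply: (@squeeze_cvgr _ _ _ _ (fun n => M - 1 / threshold d n) (fun n => M)).
- near=> n.
  have x0 : 0 < threshold d n :> R by apply: threshold_gt0; near: n; exact: nbhs_infty_gt.
  have Mx0 : 0 <= M * threshold d n by rewrite mulr_ge0 ?ltW.
  have := truncn_itv Mx0; rewrite -natr1 => /andP[l u].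
  rewrite ler_pdivrMr// l andbT ler_pdivlMr// mulrBl divfK ?gt_eqF//.
  by rewrite lerBlDr ltW.
- by rewrite -[X in _ --> X]subr0; apply: cvgB; [exact: cvg_cst|exact: cvg_thresholdV].
- exact: cvg_cst.
Unshelve. all: by end_near. Qed.

End threshold.

(** * Limit theorems *)

Lemma cvg_EFinr {R : realType} {U : Type} (F : set_system U) {FF : Filter F}
    (f : U -> R) (l : R) :
  f u @[u --> F] --> l -> (f u)%:E @[u --> F] --> l%:E.
Proof. by move=> fl; apply/fine_cvgP; split; [exact: nearW|exact: fl]. Qed.

Lemma cvg_of_fine {R : realType} {U : Type} (F : set_system U) {FF : Filter F}
    (f : U -> \bar R) (l : \bar R) :
  (forall u, f u \is a fin_num) -> l \is a fin_num ->
  fine (f u) @[u --> F] --> fine l -> f u @[u --> F] --> l.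
Proof.
move=> ffin lfin fl; rewrite -(fineK lfin); apply/fine_cvgP.
by split; [exact: nearW|exact: fl].
Qed.

(** The Poisson variable with values in nat, the form required by the moment method; [poisson_rv] is
    its real-valued cast. *)
Definition nat_id (k : nat) : nat := k.

Lemma measurable_nat_id : measurable_fun [set: nat] nat_id.
Proof. by []. Qed.

HB.instance Definition _ :=
  isMeasurableFun.Build _ _ _ _ nat_id measurable_nat_id.

Section convergence.
Context {R : realType} (d : nat).
Hypothesis d_gt0 : (0 < d)%N.
Context {disp : nat -> measure_display} {T : forall n, measurableType (disp n)}.
Context {P : forall n, probability (T n) R}.
Variable G : forall n, random_recursive_dag (P n) d n.

(** The expectation equals [bin_moment] once m n <= n, which holds eventually. The case M = 0 serves
    below the threshold. *)
Lemma cvg_expectation_bin (M : R) (m : nat -> nat) (k : nat) :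
  (m n)%:R / threshold d n @[n --> \oo] --> M ->
  ('E_(P n)[fun w => ('C(source_count (G n) (m n) w, k)%:R)%R] @[n --> \oo] -->
    ((M ^+ d.+1 / d.+1%:R) ^+ k / k`!%:R)%:E)%E.
Proof.
move=> cvg_m.
have cvgE : (bin_moment d n k (m n))%:E @[n --> \oo] -->
    ((M ^+ d.+1 / d.+1%:R) ^+ k / k`!%:R)%:E.
  by apply: cvg_EFinr; apply: cvg_bin_moment.
apply: cvg_trans cvgE; apply: near_eq_cvg; near=> n.
by rewrite expectation_binE//; near: n; exact: near_le_of_threshold cvg_m.
Unshelve. all: by end_near. Qed.

Section poisson_limit.
Variable M : R.
Hypothesis M_gt0 : 0 < M.

Let lambda : R := M ^+ d.+1 / d.+1%:R.
Let m (n : nat) : nat := Num.truncn (M * threshold d n).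

Lemma lambda_gt0 : 0 < lambda.
Proof. by rewrite divr_gt0 ?exprn_gt0 ?ltr0n. Qed.

Lemma cvg_expectation_bin_Poi (k : nat) :
  ('E_(P n)[fun w => ('C(source_count (G n) (m n) w, k)%:R)%R] @[n --> \oo] -->
    'E_(Poi lambda)[fun i => ('C(nat_id i, k)%:R)%R])%E.
Proof.
rewrite [X in _ --> X](expectation_bin_Poi _ k lambda_gt0).
by apply: cvg_expectation_bin; apply: cvg_truncn_threshold.
Qed.

Lemma cvg_pmf_source_count (r : nat) :
  fine (P n (source_count (G n) (m n) @^-1` [set r])) @[n --> \oo] -->
    fine (Poi lambda (nat_id @^-1` [set r])).
Proof.
apply: cvg_pmf_of_bin_moments.
- by move=> n j; exact: expectation_bin_source_count_fin_num.
- by move=> j; rewrite (expectation_bin_Poi _ j lambda_gt0).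
- exact: cvg_expectation_bin_Poi.
(* The Bonferroni error of the Poisson law is a constant times the s-th term of the exponential
   series, so it tends to 0. *)
- have Es s : 'C(r + s, r)%:R * fine 'E_(Poi lambda)[fun i => ('C(nat_id i, (r + s)%N)%:R)%R]%E =
      lambda ^+ r / r`!%:R * exp_coeff lambda s.
    rewrite (expectation_bin_Poi _ (r + s) lambda_gt0)/= /exp_coeff/=.
    have /(congr1 (fun n => n%:R : R)) := bin_fact (leq_addr s r).
    rewrite addKn !natrM => Crs.
    have ifact k : k`!%:R != 0 :> R by rewrite pnatr_eq0 -lt0n fact_gt0.
    have C0 : 'C(r + s, r)%:R != 0 :> R by rewrite pnatr_eq0 -lt0n bin_gt0 leq_addr.
    by rewrite -Crs exprD; field; rewrite !ifact C0.
  under eq_fun do rewrite Es.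
  have h := cvgMr (a := lambda ^+ r / r`!%:R) (@cvg_exp_coeff R lambda).
  by rewrite mulr0 in h; exact: h.
Qed.

Lemma cvg_cdf_num_sources :
  cvg_in_distribution (fun n => num_sources (G n) (m n) : {RV (P n) >-> R})
    (poisson_rv lambda).
Proof.
move=> t _; rewrite /cdf /distribution /pushforward.
have ZE n : num_sources (G n) (m n) @^-1` `]-oo, t] =
    [set w | (source_count (G n) (m n) w)%:R <= t].
  by apply/seteqP; split => w /=; rewrite in_itv/= num_sourcesE.
have YE : poisson_rv lambda @^-1` `]-oo, t] = [set k | (nat_id k)%:R <= t].
  by apply/seteqP; split => w /=; rewrite in_itv.
rewrite YE; under eq_fun do rewrite ZE.
have [t0|t0] := ltP t 0.
  rewrite (_ : [set k | _] = set0); last first.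
    by apply/seteqP; split => // k /=; apply/negP; rewrite -ltNge (lt_le_trans t0).
  rewrite measure0; apply: cvg_near_cst; apply: nearW => n.
  rewrite (_ : [set w | _] = set0) ?measure0//.
  by apply/seteqP; split => // k /=; apply/negP; rewrite -ltNge (lt_le_trans t0).
have mle (e : measure_display) (U : measurableType e) (X : {mfun U >-> nat}) :
    measurable [set w | (X w)%:R <= t].
  exact: (measurable_preimage_nat X [set k | k%:R <= t]).
apply: cvg_of_fine => [n||].
- exact: (fin_num_measure _ _ (mle _ _ (source_count (G n) (m n)))).
- exact: (fin_num_measure _ _ (mle _ _ nat_id)).
rewrite (le_prob_cdf_nat (Poi lambda) nat_id _ t0).
under eq_fun do rewrite (le_prob_cdf_nat _ (source_count (G _) _) _ t0).
by apply: cvg_sumr => r; exact: cvg_pmf_source_count.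
Qed.

Lemma cvg_moment_num_sources (k : nat) :
  ('E_(P n)[(fun w => num_sources (G n) (m n) w ^+ k)%R] @[n --> \oo] -->
    'E_(Poi lambda)[(fun w => poisson_rv lambda w ^+ k)%R])%E.
Proof.
have [c xk] := exp_sum_bin k.
rewrite [X in _ --> X](expectation_nat_exp (Poi lambda) nat_id k c xk).
under eq_fun => n.
  rewrite (_ : (fun w => _) = (fun w => (source_count (G n) (m n) w)%:R ^+ k)).
    by rewrite (expectation_nat_exp _ _ k c xk); over.
  by apply/funext => w; rewrite num_sourcesE.
apply: cvg_nnesum => i _.
  apply: nearW => n; rewrite mule_ge0 ?lee_fin//.
  exact: expectation_ge0.
by apply: cvgeZl => //; exact: cvg_expectation_bin_Poi.
Qed.

End poisson_limit.

(** * Existence of sources below and above the threshold *)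

Lemma source_le_eventE (n m : nat) :
  [set w | sources (G n) w `&` [set v | (1 <= v <= m)%N] !=set0] =
  ~` (source_count (G n) m @^-1` [set 0%N]).
Proof.
apply/seteqP; split => w /=.
  move=> [v [/= vs vm]]; rewrite /source_count => /eqP.
  rewrite sum_nat_seq_eq0 => /allP /(_ v).
  by rewrite mem_index_iota ltnS vm vs => /(_ isT).
move=> c0; apply: contrapT => nos; apply: c0.
rewrite /source_count big_nat big1// => v vm.
by apply/eqP; rewrite eqb0; apply/negP => vs; apply: nos; exists v.
Qed.

Lemma prob_source_leE (n m : nat) :
  P n [set w | sources (G n) w `&` [set v | (1 <= v <= m)%N] !=set0] =
  (1 - fine (P n (source_count (G n) m @^-1` [set 0%N])))%:E.
Proof.
have mS := measurable_preimage_nat (source_count (G n) m) [set 0%N].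
rewrite source_le_eventE probability_setC// EFinB fineK//.
exact: fin_num_measure.
Qed.

Lemma no_source_below_threshold (m : nat -> nat) :
  (m n)%:R / threshold d n @[n --> \oo] --> (0 : R) ->
  P n [set w | sources (G n) w `&` [set v | (1 <= v <= m n)%N] !=set0]
    @[n --> \oo] --> 0%E.
Proof.
move=> cvg_m.
under eq_fun do rewrite prob_source_leE.
apply: cvg_EFinr.
have /fine_cvg E1 := cvg_expectation_bin 0 m 1 cvg_m.
rewrite expr0n mul0r expr1 mul0r in E1.
apply: (squeeze_cvgr _ (cvg_cst 0) E1).
near=> n.
have E0 : ('E_(P n)[fun w => ('C(source_count (G n) (m n) w, 0)%:R)%R] = 1)%E.
  rewrite -(expectation_cst (P n) 1); congr expectation; apply/funext => w.
  by rewrite bin0.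
(* First moment bound: at r = 0 and s = 1 the inequality reads |P(Z = 0) - 1| <= E Z. *)
have := bonferroni_prob (P n) (source_count (G n) (m n)) 0 1
  (expectation_bin_source_count_fin_num (G n) (m n)).
rewrite big_ord1/= !add0n !bin0 expr0 !mul1r E0/= distrC => h.
rewrite (le_trans (ler_norm _) h) andbT subr_ge0.
rewrite -lee_fin fineK ?probability_le1//.
- exact: measurable_preimage_nat.
- exact/fin_num_measure/measurable_preimage_nat.
Unshelve. all: by end_near. Qed.

(** For each fixed M, m eventually exceeds M times the threshold, so P(Z = 0) is at most the same
    probability for the first M n^(d/(d+1)) vertices, which tends to exp(- lambda). A large M makes
    this limit small. *)
Lemma source_above_threshold (m : nat -> nat) :
  ((m n)%:R / threshold d n : R) @[n --> \oo] --> +oo ->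
  P n [set w | sources (G n) w `&` [set v | (1 <= v <= m n)%N] !=set0]
    @[n --> \oo] --> 1%E.
Proof.
move=> cvg_m.
under eq_fun do rewrite prob_source_leE.
apply: cvg_EFinr.
have P0_ge0 n k : 0 <= fine (P n (source_count (G n) k @^-1` [set 0%N])).
  exact: fine_ge0.
apply/cvgrPdist_le => e e0.
(* If lambda >= K then exp(- lambda) <= 1 / (1 + lambda) <= 1 / K = e / 2. The choice of M below
   ensures this: M >= 1 gives M^(d+1) >= M >= (d + 1) K. *)
pose K := 2 / e; have K0 : 0 < K by rewrite divr_gt0.
pose M := d.+1%:R * (K + 1); have M1 : 1 <= M.
  have d1 : 1 <= d.+1%:R :> R by rewrite ler1n.
  by rewrite /M; nra.
have M0 : 0 < M by apply: lt_le_trans M1.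
pose lambda := M ^+ d.+1 / d.+1%:R.
have lambdaK : K <= lambda.
  rewrite ler_pdivlMr ?ltr0n// mulrC; apply: le_trans (_ : M <= _).
    by rewrite /M ler_pM2l ?ltr0n// lerDl.
  by rewrite exprS ler_peMr ?exprn_ege1// ltW.
have PoiE : fine (Poi lambda (nat_id @^-1` [set 0%N])) <= e / 2.
  have l0 : 0 < lambda by exact: lt_le_trans lambdaK.
  rewrite [X in fine X](_ : _ = Poi lambda [set 0%N])// Poi_set1//=.
  rewrite /poisson_pmf l0 expr0 fact0 mul1r invr1 mul1r expRN.
  rewrite -[leRHS]invrK lef_pV2 ?posrE ?expR_gt0 ?invr_gt0 ?divr_gt0//.
  rewrite invf_div; apply: le_trans (expR_ge1Dx _).
  by rewrite (le_trans lambdaK)// lerDr.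
have cvg0 := cvg_pmf_source_count M M0 0.
have e2 : 0 < e / 2 by rewrite divr_gt0.
have cvg0e : \forall n \near \oo, `|fine (Poi lambda (nat_id @^-1` [set 0%N])) -
   fine (P n (source_count (G n) (Num.truncn (M * threshold d n)) @^-1` [set 0%N]))| <= e / 2.
  by move/cvgrPdist_le: cvg0; apply.
near=> n.
rewrite opprB addrCA subrr addr0 ger0_norm//.
have x0 : 0 < threshold d n :> R by apply: threshold_gt0; near: n; exact: nbhs_infty_gt.
have mM : (Num.truncn (M * threshold d n) <= m n)%N.
  rewrite -(ler_nat R); apply: le_trans (_ : M * threshold d n <= _).
    by rewrite truncn_le mulr_ge0 ?ltW.
  by rewrite -ler_pdivlMr//; near: n; move/cvgryPge: cvg_m; apply.
have : `|fine (Poi lambda (nat_id @^-1` [set 0%N])) -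
   fine (P n (source_count (G n) (Num.truncn (M * threshold d n)) @^-1` [set 0%N]))| <= e / 2.
  by near: n.
rewrite ler_norml => /andP[h _].
have : fine (P n (source_count (G n) (m n) @^-1` [set 0%N])) <=
   fine (P n (source_count (G n) (Num.truncn (M * threshold d n)) @^-1` [set 0%N])).
  have mS k := measurable_preimage_nat (source_count (G n) k) [set 0%N].
  apply: fine_le; [exact/fin_num_measure/mS|exact/fin_num_measure/mS|].
  apply: le_measure; rewrite ?inE; try exact: mS.
  move=> w /=.
  rewrite /source_count (big_cat_nat (n := (Num.truncn (M * threshold d n)).+1))//=.
  by move/eqP; rewrite addn_eq0 => /andP[/eqP].
by lra.
Unshelve. all: by end_near. Qed.

End convergence.

Theorem theorem11 (R : realType) (d : nat) (hd : (2 <= d)%N)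
    (disp : nat -> measure_display) (T : forall n : nat, measurableType (disp n))
    (P : forall n : nat, probability (T n) R)
    (G : forall n : nat, random_recursive_dag (P n) d n) :
  (forall M : R, 0 < M ->
    let Z (n : nat) : {RV (P n) >-> R} :=
      num_sources (G n) (Num.truncn (M * n%:R `^ (d%:R / d.+1%:R))) in
    let Y := poisson_rv (M ^+ d.+1 / d.+1%:R) in
    cvg_in_distribution Z Y /\
    (forall k : nat,
      ('E_(P n)[(fun w => Z n w ^+ k)%R] @[n --> \oo]
        --> 'E_(Poi (M ^+ d.+1 / d.+1%:R))[(fun w => Y w ^+ k)%R])%E)) /\
  (forall m : nat -> nat,
    (m n)%:R / (n%:R `^ (d%:R / d.+1%:R)) @[n --> \oo] --> (0 : R) ->
    P n [set w | sources (G n) w `&` [set v | (1 <= v <= m n)%N] !=set0]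
      @[n --> \oo] --> 0%E) /\
  (forall m : nat -> nat,
    ((m n)%:R / (n%:R `^ (d%:R / d.+1%:R)) : R) @[n --> \oo] --> +oo ->
    P n [set w | sources (G n) w `&` [set v | (1 <= v <= m n)%N] !=set0]
      @[n --> \oo] --> 1%E).
Proof.
have d_gt0 : (0 < d)%N by exact: leq_trans hd.
split; last first.
  split => m cvg_m.
    exact: (no_source_below_threshold _ d_gt0 G _ cvg_m).
  exact: (source_above_threshold _ d_gt0 G _ cvg_m).
move=> M M_gt0 Z Y; split.
  exact: (cvg_cdf_num_sources _ d_gt0 G _ M_gt0).
exact: (cvg_moment_num_sources _ d_gt0 G _ M_gt0).
Qed.
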